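(* For $n = 6k+1$ with $k \geq 3$, the graph $\mathscr{I}(C_n)$ is Hamilton traceable, i.e. it has a Hamiltonian path.
   Context: For a graph $G$, an $i$-set is an independent dominating set of minimum size. The $i$-graph $\mathscr{I}(G)$ has the $i$-sets of $G$ as vertices, with $X,Y$ adjacent if and only if there is an edge $xy\in E(G)$ with $x\in X$, $y \notin X$ and $Y=(X\setminus\{x\})\cup\{y\}$. $C_n$ is the cycle on $n$ vertices. *)

(* Defs.v *)
From mathcomp Require Import all_boot.

Set Implicit Arguments.
Unset Strict Implicit.
Unset Printing Implicit Defensive.

Record sgraph := SGraph {
  vert :> finType;
  edge : rel vert;
  edge_sym : symmetric edge;
  edge_irr : irreflexive edge
}.

Section IGraph.
Variable G : sgraph.
Implicit Types X Y : {set G}.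

Definition independent X : bool :=
  [forall x in X, forall y in X, ~~ edge x y].

Definition dominating X : bool :=
  [forall v, (v \in X) || [exists x in X, edge x v]].

Definition ind_dominating X : bool := independent X && dominating X.

Definition is_iset X : bool :=
  ind_dominating X && [forall Y, ind_dominating Y ==> (#|X| <= #|Y|)].

Definition iset : finType := {X : {set G} | is_iset X}.

Definition slide_rel X Y : bool :=
  [exists x, exists y, [&& edge x y, x \in X, y \notin X &
                           Y == (X :\ x) :|: [set y]]].

Definition iset_rel (X Y : iset) : bool := slide_rel (val X) (val Y).

Lemma slide_rel_sub X Y : slide_rel X Y -> slide_rel Y X.
Proof.
case/existsP=> x /existsP[y /and4P[exy xX yX /eqP->]].
have nxy : x != y by apply: contraNneq yX => <-.
apply/existsP; exists y; apply/existsP; exists x.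
rewrite edge_sym exy !inE !eqxx orbT /= (negPf nxy) /=.
apply/eqP/setP=> z; rewrite !inE.
case: (eqVneq z x) => [->|nzx] /=; first by rewrite xX orbT.
by case: (eqVneq z y) => [->|nzy] /=; rewrite ?(negPf yX) ?orbF.
Qed.

Lemma iset_rel_sym : symmetric iset_rel.
Proof. by move=> X Y; apply/idP/idP; apply: slide_rel_sub. Qed.

Lemma iset_rel_irr : irreflexive iset_rel.
Proof.
move=> X; rewrite /iset_rel /slide_rel; apply/negbTE/negP.
case/existsP=> x /existsP[y /and4P[_ _ yX /eqP eX]].
by move: yX; rewrite eX !inE eqxx orbT.
Qed.

Definition igraph : sgraph := SGraph iset_rel_sym iset_rel_irr.

(* The path is given by its first vertex [x] and the rest [p], so that it is
   never empty. *)
Definition hamilton_traceable : Prop :=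
  exists (x : G) (p : seq G),
    [/\ path (@edge G) x p, uniq (x :: p) & forall v : G, v \in x :: p].

End IGraph.

(* The vertices are the integers mod [n], and [ordS] is the successor mod [n].
   The conjunct [x != y] is redundant for [n >= 2]; it only rules out a loop
   when [n = 1]. *)
Definition cycle_rel (n : nat) (x y : 'I_n) : bool :=
  (x != y) && ((ordS x == y) || (ordS y == x)).

Lemma cycle_rel_sym n : symmetric (@cycle_rel n).
Proof. by move=> x y; rewrite /cycle_rel eq_sym orbC. Qed.

Lemma cycle_rel_irr n : irreflexive (@cycle_rel n).
Proof. by move=> x; rewrite /cycle_rel eqxx. Qed.

Definition cycle_graph (n : nat) : sgraph :=
  SGraph (@cycle_rel_sym n) (@cycle_rel_irr n).

(* Main.v *)
Require Import Defs.
From mathcomp Require Import all_boot zify.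

(** An i-set of C_n, n = 6k+1, has all its gaps equal to 3 except for two gaps
    equal to 2.  Since 3 is invertible modulo n, number the vertices so that the
    t-th one is 3t mod n.  In this numbering t and t + 2k are adjacent, and the
    i-sets are exactly the unions of two arcs of lengths l and 2k+1-l, separated
    on both sides by gaps of length 2k.  Such a set is determined by the start
    x (mod n) of its shorter arc and by the length l of that arc, 1 <= l <= k.

    The slides link (x, l) to (x, l+1), (x, l+1) to (x+1, l), and, on the top
    level, (x, k) to (x+3k+1, k).  Hence two consecutive levels are spanned by a
    zigzag, and the top level by steps of 3k+1, a unit modulo n.  Chaining the
    zigzags of levels (1,2), (3,4), ... and, when k is odd, the path of the top
    level, gives a Hamiltonian path. *)

Set Implicit Arguments.
Unset Strict Implicit.
Unset Printing Implicit Defensive.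

Section CycleIGraph.
Variables n k : nat.
Hypothesis n_eq : n = 6 * k + 1.
Hypothesis k_gt0 : 0 < k.

Local Notation G := (cycle_graph n).

(** * Numbering of the vertices by multiples of 3 *)

Lemma n_gt0 : 0 < n. Proof. lia. Qed.

Definition vtx (t : nat) : 'I_n := Ordinal (ltn_pmod (3 * t) n_gt0).

Lemma eq_vtx t t' : (vtx t == vtx t') = (t == t' %[mod n]).
Proof.
apply/eqP/eqP => [/(congr1 val)/= e|e]; last first.
  by apply: val_inj; rewrite /= -modnMmr e modnMmr.
(* [4 * k + 1] is the inverse of 3, as [3 * (4 * k + 1) = 2 * n + 1]. *)
have inv3 s : (4 * k + 1) * (3 * s) = s %[mod n].
  by rewrite (_ : _ * _ = 2 * s * n + s) ?modnMDl // n_eq; lia.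
by rewrite -inv3 -modnMmr e modnMmr inv3.
Qed.

Lemma vtxDn t : vtx (t + n) = vtx t.
Proof. by apply/eqP; rewrite eq_vtx modnDr. Qed.

Lemma vtx_surj x (u : 'I_n) : exists2 j, j < n & u = vtx (x + j).
Proof.
exists (((4 * k + 1) * u + (n - x %% n)) %% n); first by rewrite ltn_pmod ?n_gt0.
apply: val_inj => /=.
rewrite -modnMmr modnDmr -(modnDml x) addnCA subnKC; last first.
  by rewrite ltnW // ltn_pmod ?n_gt0.
rewrite modnDr modnMmr (_ : 3 * _ = 2 * u * n + u); last first.
  by rewrite [X in _ = _ * X + _]n_eq; lia.
by rewrite modnMDl modn_small.
Qed.

Lemma vtx_addI x j j' : j < n -> j' < n -> vtx (x + j) = vtx (x + j') -> j = j'.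
Proof. by move=> jn j'n /eqP; rewrite eq_vtx eqn_modDl !modn_small // => /eqP. Qed.

Lemma eq_vtx_add x j j' : j < n -> j' < n ->
  (vtx (x + j) == vtx (x + j')) = (j == j').
Proof. by move=> jn j'n; rewrite eq_vtx eqn_modDl !modn_small. Qed.

Lemma ordS_vtx t : ordS (vtx (t + 2 * k)) = vtx t.
Proof.
apply: val_inj; rewrite /= -addn1 modnDml (_ : _ + 1 = 3 * t + n) ?modnDr //.
by rewrite n_eq; lia.
Qed.

(** Taking the successor lowers the index by [2 * k]; in [nat] this becomes adding
    [n - 2 * k = 4 * k + 1]. *)
Lemma ordS_vtxE t : ordS (vtx t) = vtx (t + (4 * k + 1)).
Proof.
rewrite -(vtxDn t) -(ordS_vtx (t + (4 * k + 1))); congr (ordS (vtx _)); rewrite n_eq; lia.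
Qed.

Lemma edge_vtx t : edge (vtx t : G) (vtx (t + 2 * k)).
Proof.
rewrite /= /cycle_rel ordS_vtx eqxx orbT andbT.
apply/eqP => e; have : 0 = 2 * k; last by lia.
by apply: (@vtx_addI t); rewrite ?addn0 //; lia.
Qed.

Lemma edge_ordS (u : G) : edge u (ordS u : 'I_n).
Proof.
have [j _ ->] := vtx_surj (2 * k) u.
by rewrite addnC ordS_vtx edge_sym edge_vtx.
Qed.

(** * Size of an independent dominating set *)

Definition gap2_starts (X : {set G}) : {set G} :=
  [set u | (u \in X) && (ordS (ordS (u : 'I_n)) \in X)].

(* Every window of three consecutive vertices meets [X] once, or twice
   when both of its ends are in [X]. *)
Lemma card_ind_dominating (X : {set G}) : ind_dominating X ->
  3 * #|X| = n + #|gap2_starts X|.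
Proof.
case/andP=> /forall_inP indX /forallP domX.
have cardE (A : {set G}) : #|A| = \sum_(u : 'I_n) (u \in A).
  by rewrite -sum1_card big_mkcond; apply: eq_bigr => u _; case: (u \in A).
(* As [ordS] is a bijection, each of the three positions in a window contributes [#|X|] to the sum
   over all windows. *)
have shift : \sum_(u : 'I_n) (ordS u \in X) = #|X|.
  by rewrite cardE [RHS](reindex_inj (@ordS_inj n)).
have shift2 : \sum_(u : 'I_n) (ordS (ordS u) \in X) = #|X|.
  by rewrite -shift [RHS](reindex_inj (@ordS_inj n)).
have nE : n = \sum_(u : 'I_n) 1 by rewrite sum1_card card_ord.
have -> : 3 * #|X| = #|X| + #|X| + #|X| by lia.
rewrite -{2}shift -{2}shift2 !cardE [X in _ = X + _]nE -!big_split /=.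
apply: eq_bigr => u _; rewrite inE.
have iu (w : 'I_n) : w \in X -> ordS w \in X -> False.
  move=> wX swX; have /forall_inP/(_ _ swX)/negP := indX _ wX.
  by apply; apply: edge_ordS.
have d : [|| u \in X, ordS u \in X | ordS (ordS u) \in X].
  case/orP: (domX (ordS u)) => [->|/existsP[w /andP[wX /andP[_ /orP[]]]]].
  - by rewrite orbT.
  - by move/eqP/ordS_inj=> <-; rewrite wX.
  - by move/eqP->; rewrite wX !orbT.
move: d (iu u) (iu (ordS u)).
by case: (u \in X); case: (ordS u \in X); case: (ordS _ \in X) => //= _ h1 h2;
   exfalso; auto.
Qed.

(** * Sets made of two arcs *)

Definition arc_pred l j := (j < l) || (l + 2 * k <= j < 4 * k + 1).

(* The arcs [x, x+l) and [x+l+2k, x+4k+1) in the numbering [vtx]. *)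
Definition arcs x l : {set G} :=
  [set vtx (x + j) | j : 'I_n & arc_pred l j].

Lemma mem_arcs x l j : j < n -> (vtx (x + j) \in arcs x l) = arc_pred l j.
Proof.
move=> jn; apply/imsetP/idP => [[i]|h]; last by exists (Ordinal jn); rewrite ?inE.
by rewrite inE => h /vtx_addI ->.
Qed.

Lemma mem_arcs_wrap x l j : n <= j < n + n ->
  (vtx (x + j) \in arcs x l) = arc_pred l (j - n).
Proof.
move=> jn; rewrite -(mem_arcs x l); last lia.
by rewrite -(vtxDn (x + (j - n))) -addnA subnK //; lia.
Qed.

Lemma eq_arcs x y l : x = y %[mod n] -> arcs x l = arcs y l.
Proof.
move=> e; apply: eq_imset => j; apply/eqP.
by rewrite eq_vtx eqn_modDr e.
Qed.

Lemma arcsP x l (X : {set G}) :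
  (forall j, j < n -> (vtx (x + j) \in X) = arc_pred l j) -> X = arcs x l.
Proof.
move=> h; apply/setP => u; have [j jn ->] := vtx_surj x u.
by rewrite h // mem_arcs.
Qed.

(** Reading the set from its second arc exchanges the two lengths, so the arc read first can always
    be chosen of length at most [k]. *)
Lemma arcs_swap x l : 1 <= l <= 2 * k ->
  arcs x l = arcs (x + (l + 2 * k)) (2 * k + 1 - l).
Proof.
move=> hl; apply: arcsP => j jn; rewrite -addnA.
case: (ltnP (l + 2 * k + j) n) => h.
  by rewrite mem_arcs // /arc_pred; lia.
by rewrite mem_arcs_wrap /arc_pred; lia.
Qed.

Lemma card_arcs x l : 1 <= l <= 2 * k -> #|arcs x l| = 2 * k + 1.
Proof.
move=> hl; rewrite card_in_imset; last first.
  by move=> i j _ _ /vtx_addI e; apply: val_inj; apply: e.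
rewrite -sum1_card big_mkcond /=.
have count m : \sum_(j < m) (arc_pred l j : nat)
    = minn m l + (minn m (4 * k + 1) - (l + 2 * k)).
  elim: m => [|m IH]; first by rewrite big_ord0; lia.
  by rewrite big_ord_recr /= IH /arc_pred; lia.
transitivity (\sum_(j < n) (arc_pred l j : nat)); last by rewrite count; lia.
by apply: eq_bigr => j _; rewrite inE; case: arc_pred.
Qed.

(** A step of [2 * k] either way from an arc lands in a gap, since gaps have length [2 * k] and arcs
    at most that. From a gap, one of the two steps lands in an arc, since the arc lengths add up to
    [2 * k + 1]. *)
Lemma arcs_ind_dominating x l : 1 <= l <= 2 * k -> ind_dominating (arcs x l).
Proof.
move=> hl.
have nadj (w : 'I_n) : w \in arcs x l -> ordS w \in arcs x l -> False.
  have [j jn ->] := vtx_surj x w; rewrite mem_arcs // ordS_vtxE -addnA.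
  case: (ltnP (j + (4 * k + 1)) n) => h.
    by rewrite mem_arcs // /arc_pred; lia.
  by rewrite mem_arcs_wrap /arc_pred; lia.
apply/andP; split.
  apply/forall_inP => u uX; apply/forall_inP => w wX; apply/negP => /andP[_].
  by case/orP=> /eqP e; [apply: (nadj u) | apply: (nadj w)]; rewrite ?e.
apply/forallP => u; have [j jn ->] := vtx_surj x u.
have [a|a] := boolP (arc_pred l j); first by rewrite mem_arcs // a.
apply/orP; right; apply/existsP.
have [b|b] := boolP (vtx (x + j + 2 * k) \in arcs x l).
  by exists (vtx (x + j + 2 * k)); rewrite b edge_sym edge_vtx.
exists (vtx (x + j + (4 * k + 1))); apply/andP; split; last first.
  by rewrite -ordS_vtxE edge_sym edge_ordS.
move: a b; rewrite -!addnA /arc_pred.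
have [h1|h1] := ltnP (j + 2 * k) n; have [h2|h2] := ltnP (j + (4 * k + 1)) n.
- by rewrite !mem_arcs // /arc_pred; lia.
- by rewrite mem_arcs // mem_arcs_wrap /arc_pred; lia.
- lia.
- by rewrite !mem_arcs_wrap /arc_pred; lia.
Qed.

(** For an independent dominating [Y], [3 * #|Y| >= 6 * k + 1] forces [#|Y| >= 2 * k + 1]. *)
Lemma arcs_iset x l : 1 <= l <= 2 * k -> is_iset (arcs x l).
Proof.
move=> hl; apply/andP; split; first exact: arcs_ind_dominating.
apply/forallP => Y; apply/implyP => /card_ind_dominating.
by rewrite card_arcs //; lia.
Qed.

(** * Slides between two-arc sets *)

Lemma slide_arcs x l : 1 <= l < 2 * k -> slide_rel (arcs x l) (arcs x l.+1).
Proof.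
(* The first vertex of the second arc moves to the place just after the first arc. *)
move=> hl; apply/existsP; exists (vtx (x + (l + 2 * k))).
apply/existsP; exists (vtx (x + l)).
rewrite !mem_arcs; try lia.
rewrite addnA edge_sym edge_vtx -addnA /=; apply/and3P; split.
- by rewrite /arc_pred; lia.
- by rewrite /arc_pred; lia.
apply/eqP/esym/arcsP => j jn; rewrite !inE mem_arcs // !eq_vtx_add /arc_pred; lia.
Qed.

Lemma slide_arcs_succ x l : 1 <= l < 2 * k ->
  slide_rel (arcs x l.+1) (arcs x.+1 l).
Proof.
(* The first vertex of the first arc moves to the place just after the second arc. *)
move=> hl; apply/existsP; exists (vtx (x + 0)).
apply/existsP; exists (vtx (x + (4 * k + 1))).
apply/and4P; split.
- by rewrite addn0 -ordS_vtxE edge_ordS.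
- by rewrite mem_arcs /arc_pred; lia.
- by rewrite mem_arcs /arc_pred; lia.
apply/eqP/esym/arcsP => j jn; rewrite addSnnS !inE.
have [h|h] := ltnP j.+1 n.
  by rewrite mem_arcs // !eq_vtx_add /arc_pred; lia.
(* The last index from base [x.+1] wraps around to [x], the vertex removed. *)
have -> : j.+1 = n by lia.
by rewrite vtxDn -[X in vtx X](addn0 x) eqxx eq_vtx_add /arc_pred; lia.
Qed.

(** Lengthening the first arc to [k + 1] leaves [k] for the second, which becomes the shorter one
    and starts at [x + (3 * k + 1)]. *)
Lemma slide_arcs_top x : 1 < k ->
  slide_rel (arcs x k) (arcs (x + (3 * k + 1)) k).
Proof.
move=> k1; have := @slide_arcs x k; rewrite (arcs_swap x (l := k.+1)); last lia.
have -> : k.+1 + 2 * k = 3 * k + 1 by lia.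
have -> : 2 * k + 1 - k.+1 = k by lia.
apply; lia.
Qed.

(** * Parametrisation of the i-sets by start and length *)

Lemma arcs_inj x d l m : d < n -> 1 <= l <= k -> 1 <= m <= k ->
  arcs x l = arcs (x + d) m -> d = 0 /\ l = m.
Proof.
move=> dn hl hm e.
have mem j : j < n -> (vtx (x + (d + j)) \in arcs x l) = arc_pred m j.
  by move=> jn; rewrite e addnA mem_arcs.
have h0 := mem 0 n_gt0; rewrite addn0 mem_arcs // in h0.
(* The index before [d], written [d + n.-1], is outside the set, so a member [d] starts one of the
   two arcs. *)
have hm1 : arc_pred l d -> d = 0 \/ d = l + 2 * k.
  case: (posnP d) => [->|d0]; first by left.
  have := mem n.-1; have -> : d + n.-1 = n + d.-1 by lia.
  rewrite mem_arcs_wrap; last lia.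
  by rewrite /arc_pred; lia.
have {}h0 : arc_pred l d by rewrite h0 /arc_pred; lia.
case: (hm1 h0) => hd; subst d.
  split=> //; move: (mem l) (mem m); rewrite !add0n !mem_arcs; try lia.
  by rewrite /arc_pred; lia.
(* The second arc has length [2 * k + 1 - l > k >= m], so it cannot stop after [m] vertices. *)
have := mem m; rewrite mem_arcs; last lia.
by rewrite /arc_pred; lia.
Qed.

(** Comparison with [arcs 0 1] gives [2 * k + 1] elements, hence exactly two gaps of length 2. In
    the numbering by [vtx], a run of members can end only where such a gap starts, which leaves two
    runs. *)
Lemma iset_arcs (X : {set G}) : is_iset X ->
  exists x l, 1 <= l <= k /\ X = arcs x l.
Proof.
case/andP=> idX /forallP minX.
have idA : ind_dominating (arcs 0 1) by apply: arcs_ind_dominating; lia.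
have cD := card_ind_dominating idX.
have {minX} := implyP (minX (arcs 0 1)) idA; rewrite card_arcs => [cX|]; last lia.
have /eqP/cards2P[d [d' [nd eD]]] : #|gap2_starts X| = 2 by lia.
(* Indices are counted from one gap start, [t]; the other one is at distance [e]. *)
have [t _ dE] := vtx_surj 0 d; rewrite add0n in dE; subst d.
have [e en dE] := vtx_surj t d'; subst d'.
have e0 : 0 < e by case: (posnP e) nd => // ->; rewrite addn0 eqxx.
pose g j := vtx (t + j) \in X.
have gP j : g (j + n) = g j by rewrite /g addnA vtxDn.
case/andP: idX => /forall_inP indX /forallP domX.
have nadj j : g j -> g (j + 2 * k) = false.
  move=> gj; apply/negP => gj2.
  have /forall_inP/(_ _ gj2)/negP := indX _ gj.
  by rewrite addnA; apply; apply: edge_vtx.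
(* Two successors lower the index by [4 * k], that is, raise it by [2 * k + 1] modulo [n]. *)
have inD j : (vtx (t + j) \in gap2_starts X) = g j && g (j + (2 * k + 1)).
  rewrite inE !ordS_vtxE /g -(vtxDn (t + (j + (2 * k + 1)))); congr (_ && _).
  by rewrite (_ : t + (j + _) + n = t + j + (4 * k + 1) + (4 * k + 1)) //; lia.
have dom j : [|| g j, g (j + 2 * k) | g (j + (4 * k + 1))].
  case/orP: (domX (vtx (t + j))) => [gj|].
    by rewrite /g gj.
  case/existsP=> w /andP[wX /andP[_ /orP[]/eqP ew]].
    move: ew; rewrite -(ordS_vtx (t + j)) => /ordS_inj ew.
    by rewrite /g addnA -ew wX orbT.
  by rewrite /g (addnA t j (4 * k + 1)) -ordS_vtxE ew wX !orbT.
have nadj' j : g j -> g (j + (4 * k + 1)) = false.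
  move=> gj; apply/negP => /nadj; have -> : j + (4 * k + 1) + 2 * k = j + n by lia.
  by rewrite gP gj.
(* The neighbours of index [j + (2 * k + 1)] are [j.+1], outside by assumption, and
   [j + (4 * k + 1)], a neighbour of the member [j]. So [j + (2 * k + 1)] itself must be a
   member. *)
have ends j : g j -> g j.+1 = false -> vtx (t + j) \in gap2_starts X.
  move=> gj gj1; rewrite inD gj /=; have := dom (j + (2 * k + 1)).
  have -> : j + (2 * k + 1) + 2 * k = j + (4 * k + 1) by lia.
  have -> : j + (2 * k + 1) + (4 * k + 1) = j.+1 + n by lia.
  by rewrite gP gj1 nadj' // !orbF.
have inDE j : j < n -> (vtx (t + j) \in gap2_starts X) = (j == 0) || (j == e).
  by move=> jn; rewrite eD !inE -{2}(addn0 t) !eq_vtx_add //; lia.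
have D0 : vtx (t + 0) \in gap2_starts X by rewrite inDE //; lia.
have De : vtx (t + e) \in gap2_starts X by rewrite inDE // eqxx orbT.
rewrite inD in D0; case/andP: D0 => g0 g2k1; rewrite add0n in g2k1.
rewrite inD in De; case/andP: De => ge ge2k1.
have g2k : g (2 * k) = false by have := nadj _ g0; rewrite add0n.
have ge2k := nadj _ ge.
have step j : 0 < j < n -> j != e -> g j -> g j.+1.
  move=> jn je gj; apply/negPn/negP => /negPf/(ends _ gj).
  by rewrite inDE; lia.
have up a b : 0 < a -> a <= b <= n -> e < a \/ b <= e -> g a -> g b.
  move=> a0; elim: b => [|b IH] hb he ga; first by lia.
  have [<-//|nab] := eqVneq a b.+1.
  by apply: step; [lia|lia|apply: IH => //; lia].
(* Otherwise the run starting at [2 * k + 1] would not end before [e + 2 * k], a neighbour of the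
   member [e]. *)
have e2k : 2 * k < e.
  rewrite ltnNge; apply/negP => h.
  have : g (e + 2 * k) by apply: (up (2 * k + 1)) => //; lia.
  by rewrite ge2k.
have z1 j : 0 < j <= 2 * k -> g j = false.
  move=> hj; apply/negP => /(up _ (2 * k)); rewrite g2k => H.
  by suff: false by []; apply: H; lia.
have e4k : e + 2 * k < n.
  rewrite ltnNge; apply/negP => h.
  have := z1 (e + (2 * k + 1) - n); rewrite -gP subnK; last lia.
  by rewrite ge2k1 => H; suff: true = false by []; apply: H; lia.
have z2 j : e < j <= e + 2 * k -> g j = false.
  move=> hj; apply/negP => /(up _ (e + 2 * k)); rewrite ge2k => H.
  by suff: false by []; apply: H; lia.
have o1 j : 2 * k + 1 <= j <= e -> g j.
  by move=> hj; apply: (up (2 * k + 1)) => //; lia.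
have o2 j : e + (2 * k + 1) <= j <= n -> g j.
  by move=> hj; apply: (up (e + (2 * k + 1))) => //; lia.
(* The runs are [2 * k + 1] to [e] and [e + (2 * k + 1)] to [n]; index [n] is the base [t]
   itself. *)
have XE : X = arcs (t + (2 * k + 1)) (e - 2 * k).
  apply: arcsP => j jn; rewrite -addnA -/(g _).
  have [h1|h1] := leqP (2 * k + 1 + j) e.
    by rewrite o1 /arc_pred; lia.
  have [h2|h2] := leqP (2 * k + 1 + j) (e + 2 * k).
    by rewrite z2 /arc_pred; lia.
  have [h3|h3] := leqP (2 * k + 1 + j) n.
    by rewrite o2 /arc_pred; lia.
  by rewrite (_ : _ + j = 2 * k + 1 + j - n + n) ?gP ?z1 /arc_pred; lia.
have [lk|lk] := leqP (e - 2 * k) k.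
  by exists (t + (2 * k + 1)), (e - 2 * k); split=> //; lia.
exists (t + (2 * k + 1) + (e - 2 * k + 2 * k)), (2 * k + 1 - (e - 2 * k)).
by split; [lia|rewrite XE arcs_swap //; lia].
Qed.

(** * The i-graph in the coordinates start and length *)

Lemma arcs10_iset : is_iset (arcs 0 1).
Proof. by apply: arcs_iset; lia. Qed.

(* The default [arcs 0 1] is a junk value for [l] outside of [1, 2k]. *)
Definition iarcs x l : igraph G := insubd (Sub (arcs 0 1) arcs10_iset) (arcs x l).

Lemma val_iarcs x l : 1 <= l <= 2 * k -> val (iarcs x l) = arcs x l.
Proof. by move=> hl; rewrite val_insubd arcs_iset. Qed.

Lemma eq_iarcs x y l : x = y %[mod n] -> iarcs x l = iarcs y l.
Proof. by move=> e; rewrite /iarcs (eq_arcs _ e). Qed.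

Lemma iarcs_surj (X : igraph G) : exists x l, 1 <= l <= k /\ X = iarcs x l.
Proof.
have [x [l [hl XE]]] := iset_arcs (valP X).
by exists x, l; split=> //; apply: val_inj; rewrite val_iarcs -?XE //; lia.
Qed.

Lemma iarcs_inj x y l m : x < n -> y < n -> 1 <= l <= k -> 1 <= m <= k ->
  iarcs x l = iarcs y m -> x = y /\ l = m.
Proof.
wlog le_xy : x y l m / x <= y => [H|] xn yn hl hm e.
  have [le|lt] := leqP x y; first exact: H.
  by have [] := H y x m l (ltnW lt) yn xn hm hl (esym e).
move/(congr1 val): e; rewrite !val_iarcs; try lia.
rewrite -(subnKC le_xy) => /arcs_inj[]; lia.
Qed.

(** This bound makes any list of [n * k] vertices that covers the i-graph free of repetitions. *)
Lemma card_igraph : n * k <= #|igraph G|.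
Proof.
pose f (q : 'I_n * 'I_k) := iarcs q.1 q.2.+1.
have f_inj : injective f.
  move=> [x l] [y m] e.
  have [/val_inj-> [] /val_inj->] // :=
    @iarcs_inj x y l.+1 m.+1 (ltn_ord x) (ltn_ord y) (ltn_ord l) (ltn_ord m) e.
by have := leq_card f f_inj; rewrite card_prod !card_ord.
Qed.

Lemma edge_iarcs x l : 1 <= l < 2 * k -> edge (iarcs x l) (iarcs x l.+1).
Proof.
move=> hl; rewrite /= /iset_rel !val_iarcs; try lia.
exact: slide_arcs.
Qed.

Lemma edge_iarcs_succ x l : 1 <= l < 2 * k -> edge (iarcs x l.+1) (iarcs x.+1 l).
Proof.
move=> hl; rewrite /= /iset_rel !val_iarcs; try lia.
exact: slide_arcs_succ.
Qed.

Lemma edge_iarcs_top x : 1 < k -> edge (iarcs x k) (iarcs (x + (3 * k + 1)) k).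
Proof.
move=> k1; rewrite /= /iset_rel !val_iarcs; try lia.
exact: slide_arcs_top.
Qed.

(** * Paths through the levels *)

Lemma modn_add_surj x y : exists2 j, j < n & y = x + j %[mod n].
Proof.
have [j jn /eqP] := vtx_surj x (vtx y).
by rewrite eq_vtx => /eqP; exists j.
Qed.

(** The order is [(x, l)], [(x, l+1)], [(x+1, l)], [(x+1, l+1)] and so on, through [n] starts. The
    final start [y] may stay unspecified, because the next zigzag can begin at any start. *)
Lemma zigzag_path x l : 1 <= l < 2 * k ->
  exists p y, [/\ path (@edge (igraph G)) (iarcs x l) p,
    last (iarcs x l) p = iarcs y l.+1, (size p).+1 = n * 2 &
    forall z m, l <= m <= l.+1 -> iarcs z m \in iarcs x l :: p].
Proof.
move=> hl.
have H j : exists p, [/\ path (@edge (igraph G)) (iarcs x l) p,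
    last (iarcs x l) p = iarcs (x + j) l.+1, (size p).+1 = j.+1 * 2 &
    forall i, i <= j -> (iarcs (x + i) l \in iarcs x l :: p)
                     && (iarcs (x + i) l.+1 \in iarcs x l :: p)].
  elim: j => [|j [p [pp lp sp cp]]].
    exists [:: iarcs x l.+1]; rewrite addn0; split=> //=.
      by rewrite andbT; apply: edge_iarcs.
    by case=> // _; rewrite addn0 !inE !eqxx orbT.
  exists (p ++ [:: iarcs (x + j.+1) l; iarcs (x + j.+1) l.+1]); split.
  - rewrite cat_path pp lp; apply/and3P; split=> //.
      by rewrite addnS; apply: edge_iarcs_succ.
    by rewrite /= andbT; apply: edge_iarcs.
  - by rewrite last_cat.
  - by rewrite size_cat -addSn sp /=; lia.
  - move=> i; rewrite -cat_cons !mem_cat leq_eqVlt ltnS => /predU1P[->|/cp/andP[-> ->] //].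
    by rewrite !inE !eqxx !orbT.
have [p [pp lp sp cp]] := H n.-1.
exists p, (x + n.-1); split=> //; first by rewrite sp; lia.
move=> z m hm; have [j jn /eq_iarcs ->] := modn_add_surj x z.
have /andP[cl cl1] := cp j ltac:(lia).
by have [->|ne] := eqVneq m l; last have -> : m = l.+1 by lia.
Qed.

(* [3k + 1] is the inverse of 2 modulo [n]. *)
Lemma top_path x : 1 < k ->
  exists p, [/\ path (@edge (igraph G)) (iarcs x k) p, (size p).+1 = n &
    forall z, iarcs z k \in iarcs x k :: p].
Proof.
move=> k1.
have H j : exists p, [/\ path (@edge (igraph G)) (iarcs x k) p,
    last (iarcs x k) p = iarcs (x + (3 * k + 1) * j) k, size p = j &
    forall i, i <= j -> iarcs (x + (3 * k + 1) * i) k \in iarcs x k :: p].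
  elim: j => [|j [p [pp lp sp cp]]].
    exists [::]; rewrite muln0 addn0; split=> //.
    by case=> // _; rewrite muln0 addn0 inE.
  exists (rcons p (iarcs (x + (3 * k + 1) * j.+1) k)); split.
  - rewrite rcons_path pp lp mulnSr addnA; exact: edge_iarcs_top.
  - by rewrite last_rcons.
  - by rewrite size_rcons sp.
  - move=> i; rewrite -rcons_cons mem_rcons inE leq_eqVlt ltnS.
    by move=> /predU1P[->|/cp ->]; rewrite ?eqxx ?orbT.
have [p [pp _ sp cp]] := H n.-1.
exists p; split=> //; first by rewrite sp; lia.
move=> z; have [j jn /eq_iarcs ->] := modn_add_surj x z.
(* Offset [j] is reached after [2 * j] steps, as [2 * (3 * k + 1) = n + 1]. *)
have -> : iarcs (x + j) k = iarcs (x + (3 * k + 1) * ((2 * j) %% n)) k.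
  apply: eq_iarcs; rewrite -(modnDmr x (_ * _)) modnMmr modnDmr.
  by rewrite (_ : x + _ * _ = j * n + (x + j)) ?modnMDl // n_eq; lia.
by apply: cp; have := ltn_pmod (2 * j) n_gt0; lia.
Qed.

(** A zigzag ends on its upper level, at some start [y]; lengthening the arc there by one enters the
    next pair of levels. *)
Lemma even_levels_path h : 0 < h -> h * 2 <= k ->
  exists p y, [/\ path (@edge (igraph G)) (iarcs 0 1) p,
    last (iarcs 0 1) p = iarcs y (h * 2), (size p).+1 = n * (h * 2) &
    forall z m, 1 <= m <= h * 2 -> iarcs z m \in iarcs 0 1 :: p].
Proof.
elim: h => [//|h IH] _ hk; case: (posnP h) => [->|h0].
  by apply: zigzag_path; lia.
have [|p [y [pp lp sp cp]]] := IH h0; first lia.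
have [|q [y' [qq lq sq cq]]] := @zigzag_path y (h * 2).+1; first lia.
exists (p ++ iarcs y (h * 2).+1 :: q), y'; split.
- rewrite cat_path pp lp; apply/and3P; split=> //.
  by apply: edge_iarcs; lia.
- by rewrite last_cat.
- by rewrite size_cat -addSn sp [X in _ + X]sq; lia.
- move=> z m hm; rewrite -cat_cons mem_cat; apply/orP.
  have [le|lt] := leqP m (h * 2); [left; apply: cp|right; apply: cq]; lia.
Qed.

Lemma igraph_cycle_traceable : 1 < k -> hamilton_traceable (igraph G).
Proof.
move=> k1.
(* Uniqueness is replaced by a length count: a covering list no longer than the number of vertices
   has no repetition. *)
suff [p [pp sp cp]] : exists p, [/\ path (@edge (igraph G)) (iarcs 0 1) p,
    (size p).+1 = n * k &
    forall z m, 1 <= m <= k -> iarcs z m \in iarcs 0 1 :: p].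
  have cover X : X \in iarcs 0 1 :: p.
    by have [x [l [hl ->]]] := iarcs_surj X; apply: cp.
  exists (iarcs 0 1), p; split=> //.
  apply: (leq_size_uniq (enum_uniq (igraph G))) => //.
  by rewrite -cardE /= sp card_igraph.
have kE := odd_double_half k; rewrite -muln2 in kE.
have [||p [y [pp lp sp cp]]] := @even_levels_path k./2; try lia.
case: (odd k) kE => /= kE; last first.
  by exists p; rewrite -kE add0n.
(* For odd [k] the zigzags stop at level [k - 1], and one more edge leads to the top level. *)
have [q [qq sq cq]] := top_path y k1.
exists (p ++ iarcs y k :: q); split.
- rewrite cat_path pp lp; apply/and3P; split=> //.
  by rewrite -{2}kE add1n; apply: edge_iarcs; lia.
- by rewrite size_cat -addSn sp [X in _ + X]sq; lia.
- move=> z m hm; rewrite -cat_cons mem_cat; apply/orP.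
  have [le|lt] := leqP m (k./2 * 2); first by left; apply: cp; lia.
  by right; have -> : m = k by lia.
Qed.

End CycleIGraph.

Theorem mainTheorem5 (n k : nat) (hk : 3 <= k) (hn : n = 6 * k + 1) :
  hamilton_traceable (igraph (cycle_graph n)).
Proof. by apply: (igraph_cycle_traceable hn); lia. Qed.
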